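(* Let $n\geqslant 2$, let $T$ be the maximal torus of diagonal matrices in $SL_n(\Bbbk)$ and let $N(T)$ be its normalizer in $SL_n(\Bbbk)$, whose connected components are identified with the elements of the Weyl group $N(T)/T\cong S_n$. Then the periodic connected components of $N(T)$ are precisely those corresponding to the cycles of length $n$ in $S_n$, their number is $(n-1)!$, and every element of a periodic component has order $n$ if $n$ is odd and order $2n$ if $n$ is even.
   Context: $\Bbbk$ is an algebraically closed field of characteristic zero. A connected component of an affine algebraic group is called periodic if all its elements have finite order. $N(T)$ consists of the monomial matrices of determinant $1$, and the component of a monomial matrix corresponds to its underlying permutation in $S_n$. *)

(* Defs.v *)
From HB Require Import structures.
From mathcomp Require Import all_boot all_order all_algebra all_fingroup.
From mathcomp Require Import mpoly.
From mathcomp Require Import boolp classical_sets functions cardinality topology.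

Set Implicit Arguments.
Unset Strict Implicit.
Unset Printing Implicit Defensive.

Import GRing.Theory.
Local Open Scope classical_set_scope.
Local Open Scope ring_scope.

(* Value of a polynomial in n * n variables at the entries of A. *)
Definition mx_eval (k : closedFieldType) (n : nat)
    (p : {mpoly k[n * n]}) (A : 'M[k]_n) : k :=
  p.@[fun i => mxvec A ord0 i].

Definition zero_locus (k : closedFieldType) (n : nat)
    (S : set {mpoly k[n * n]}) : set 'M[k]_n :=
  [set A | forall p, S p -> mx_eval p A = 0].

(* The affine space of n x n matrices, as an alias of 'M[k]_n carrying the
   Zariski topology. Subvarieties of it have the induced topology, so their
   connected components are those given by connected_component. *)
Definition zariski_mx (k : closedFieldType) (n : nat) : Type := 'M[k]_n.

HB.instance Definition _ (k : closedFieldType) (n : nat) :=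
  Choice.on (zariski_mx k n).

Definition zariski_open (k : closedFieldType) (n : nat)
    (U : set (zariski_mx k n)) : Prop :=
  exists S : set {mpoly k[n * n]}, U = ~` zero_locus S.

Lemma zariski_openT (k : closedFieldType) (n : nat) :
  zariski_open [set: zariski_mx k n].
Proof.
exists [set (1 : {mpoly k[n * n]})]; apply/esym/seteqP; split => // A _ /(_ 1 erefl).
by rewrite /mx_eval meval1; apply/eqP; rewrite oner_eq0.
Qed.

Lemma zariski_openI (k : closedFieldType) (n : nat) :
  setI_closed (@zariski_open k n).
Proof.
move=> _ _ [S ->] [S' ->].
exists [set r | exists p q, [/\ S p, S' q & r = p * q]].
rewrite -setCU; congr (~` _); apply/seteqP; split => A /=.
  move=> hA _ [p [q [Sp Sq ->]]]; rewrite /mx_eval mevalM.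
  case: hA => hA.
    by have := hA p Sp; rewrite /mx_eval => ->; rewrite mul0r.
  by have := hA q Sq; rewrite /mx_eval => ->; rewrite mulr0.
move=> hA; have [hS|] := pselect (zero_locus S A); first by left.
move=> /existsNP[p /not_implyP[Sp /eqP pA]]; right => q S'q.
have /eqP : mx_eval (p * q) A = 0 by apply: hA; exists p, q.
rewrite /mx_eval mevalM mulf_eq0 -/(mx_eval p A) (negbTE pA) /=.
by move/eqP.
Qed.

Lemma zariski_open_bigU (k : closedFieldType) (n : nat) (I : Type)
    (U : I -> set (zariski_mx k n)) :
  (forall i, zariski_open (U i)) -> zariski_open (\bigcup_i U i).
Proof.
move=> /(_ _)/cid hU; exists (\bigcup_i sval (hU i)).
have UE i : U i = ~` zero_locus (sval (hU i)) by case: (hU i).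
apply/seteqP; split => A.
  by move=> [i _]; rewrite {1}UE => nA hA; apply: nA => p Sp; apply: hA; exists i.
move=> nA; apply: contrapT => hA; apply: nA => p [i _ Sp].
apply: contrapT => pA; apply: hA; exists i => //.
by rewrite UE => /(_ p Sp).
Qed.

HB.instance Definition _ (k : closedFieldType) (n : nat) :=
  @isOpenTopological.Build (zariski_mx k n) (@zariski_open k n)
    (@zariski_openT k n) (@zariski_openI k n) (@zariski_open_bigU k n).

Definition SL (k : closedFieldType) (n : nat) : set 'M[k]_n :=
  [set A | \det A = 1].
Arguments SL : clear implicits.

Definition torus (k : closedFieldType) (n : nat) : set 'M[k]_n :=
  [set A | SL k n A /\ is_diag_mx A].
Arguments torus : clear implicits.

Definition normalizer_SL (k : closedFieldType) (n : nat) (H : set 'M[k]_n) :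
    set 'M[k]_n :=
  [set g | SL k n g /\ [set g *m t *m invmx g | t in H] = H].

Definition is_component (k : closedFieldType) (n : nat)
    (G C : set 'M[k]_n) : Prop :=
  exists2 A, G A & C = connected_component (G : set (zariski_mx k n)) A.

(* The convention is that of perm_mx: the nonzero entry of row i is in column
   s i, which makes A |-> s multiplicative for the product of 'S_n. *)
Definition monomial_of_perm (k : closedFieldType) (n : nat) (s : 'S_n)
    (A : 'M[k]_n) : Prop :=
  forall i j, (A i j != 0) = (j == s i).

Definition perm_component (k : closedFieldType) (n : nat) (s : 'S_n) :
    set 'M[k]_n :=
  [set A | SL k n A /\ monomial_of_perm s A].
Arguments perm_component : clear implicits.

Definition has_order (k : closedFieldType) (n : nat) (A : 'M[k]_n) (m : nat) :
    Prop :=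
  [/\ (0 < m)%N, A ^+ m = 1
    & forall j : nat, (0 < j < m)%N -> A ^+ j <> 1].

Definition periodic (k : closedFieldType) (n : nat) (C : set 'M[k]_n) : Prop :=
  forall A, C A -> exists m, has_order A m.

Definition is_cycle_of_length (n r : nat) (s : 'S_n) : Prop :=
  exists c : seq 'I_n,
    [/\ size c = r, uniq c, fcycle s c & forall x, x \notin c -> s x = x].

(* Main.v *)
Require Import Defs.
From HB Require Import structures.
From mathcomp Require Import all_boot all_order all_algebra all_fingroup.
From mathcomp Require Import mpoly.
From mathcomp Require Import boolp classical_sets functions cardinality topology.

(** A matrix normalizing T conjugates a diagonal matrix with distinct entries to
    a diagonal matrix, hence is monomial. The matrices of N(T) over a given
    permutation form a relatively clopen subset of N(T), and any two of them lie
    on a rational curve inside this subset; since the line is irreducible, these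
    subsets are the components.
    If s is an n-cycle and A lies over s, every diagonal entry of A^n is the
    product of all nonzero entries of A, which is det A = 1 up to the sign
    (-1)^(n-1) of s. If s is not an n-cycle, choose the entry 2 in row x, the
    entry +-1/2 in a row outside the orbit of x, and 1 elsewhere: the entry in
    row x of a power of this matrix is 2^c with c > 0 visits to x, so no power
    is 1.
    The n-cycles are the conjugates of i |-> i + 1 by the permutations fixing 0,
    without repetition. *)

Set Implicit Arguments.
Unset Strict Implicit.
Unset Printing Implicit Defensive.

Import GRing.Theory.
Local Open Scope classical_set_scope.
Local Open Scope ring_scope.

(** * Monomial matrices and their multiplication *)

(** The coefficients are indexed by rows and may vanish, so that the determinant, product and power
    formulas hold without side conditions. *)
Definition monomial_mx (k : closedFieldType) (n : nat) (s : 'S_n)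
    (f : 'I_n -> k) : 'M[k]_n :=
  \matrix_(i, j) (f i *+ (j == s i)).

Lemma monomial_mxP (k : closedFieldType) (n : nat) (s : 'S_n) (f : 'I_n -> k) :
  (forall i, f i != 0) -> monomial_of_perm s (monomial_mx s f).
Proof. by move=> f0 i j; rewrite mxE; case: (j == s i); rewrite ?f0 ?eqxx. Qed.

Lemma monomialE (k : closedFieldType) (n : nat) (s : 'S_n) (A : 'M[k]_n) :
  monomial_of_perm s A -> A = monomial_mx s (fun i => A i (s i)).
Proof.
move=> As; apply/matrixP => i j; rewrite mxE.
case: eqP => [->//|/eqP js].
by apply/eqP; rewrite mulr0n -[_ == _]negbK As.
Qed.

Lemma monomial_mx_diag (k : closedFieldType) (n : nat) (s : 'S_n)
    (f : 'I_n -> k) i : monomial_mx s f i (s i) = f i.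
Proof. by rewrite mxE eqxx. Qed.

Lemma monomial_neq0 (k : closedFieldType) (n : nat) (s : 'S_n) (A : 'M[k]_n) i :
  monomial_of_perm s A -> A i (s i) != 0.
Proof. by move=> ->. Qed.

Lemma det_monomial_mx (k : closedFieldType) (n : nat) (s : 'S_n)
    (f : 'I_n -> k) : \det (monomial_mx s f) = (-1) ^+ s * \prod_i f i.
Proof.
rewrite /determinant (bigD1 s) //= [X in _ + X]big1 ?addr0 => [|t ts].
  by congr (_ * _); apply: eq_bigr => i _; rewrite monomial_mx_diag.
(* A permutation [t] other than [s] leaves [s] at some row, and the entry met there is zero, so its
   Leibniz term vanishes. *)
have /existsP[i si] : [exists i, t i != s i].
  apply: contraR ts => /existsPn st; apply/eqP/permP => i.
  by apply/eqP/negbNE/st.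
by rewrite (bigD1 i) //= mxE (negbTE si) mul0r mulr0.
Qed.

Lemma perm_component_monomial_mx (k : closedFieldType) (n : nat) (s : 'S_n)
    (f : 'I_n -> k) :
  (-1) ^+ s * \prod_i f i = 1 -> perm_component k n s (monomial_mx s f).
Proof.
move=> f1; split; first by rewrite /SL /= det_monomial_mx.
apply: monomial_mxP => i; apply: contra_eqN f1 => /eqP fi.
by rewrite (bigD1 i) //= fi mul0r mulr0 eq_sym oner_eq0.
Qed.

Lemma prod_perm_component (k : closedFieldType) (n : nat) (s : 'S_n)
    (A : 'M[k]_n) : perm_component k n s A -> \prod_i A i (s i) = (-1) ^+ s.
Proof.
case=> + /monomialE As; rewrite /SL /= {1}As det_monomial_mx.
move=> /(congr1 ( *%R ((-1) ^+ s))).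
by rewrite mulrA -signr_addb addbb mul1r mulr1.
Qed.

Lemma perm_component_neq0 (k : closedFieldType) (n : nat) (s : 'S_n) :
  (0 < n)%N -> perm_component k n s !=set0.
Proof.
case: n s => // n s _.
(* The single coefficient [(-1) ^+ s] cancels the sign of [s] in the determinant. *)
exists (monomial_mx s (fun i => if i == ord0 then (-1) ^+ s else 1)).
apply: perm_component_monomial_mx.
by rewrite -big_mkcond big_pred1_eq -signr_addb addbb.
Qed.

Lemma monomial_perm_inj (k : closedFieldType) (n : nat) (s t : 'S_n)
    (A : 'M[k]_n) : monomial_of_perm s A -> monomial_of_perm t A -> s = t.
Proof.
by move=> As At; apply/permP => i; apply/eqP; rewrite -At As.
Qed.

Lemma perm_component1 (k : closedFieldType) (n : nat) :
  perm_component k n 1%g = torus k n.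
Proof.
apply/seteqP; split => A [A1 dA]; split => //.
  apply/is_diag_mxP => i j ij; apply/eqP; rewrite -[_ == _]negbK dA perm1.
  by apply: contra ij => /eqP ->.
have AE : A = monomial_mx 1%g (fun i => A i i).
  apply/matrixP => i j; rewrite mxE perm1; case: eqP => [->//|/eqP ij].
  by move/is_diag_mxP: dA => -> //; apply: contra ij => /eqP/val_inj ->.
move: A1; rewrite /SL /= AE => A1.
have [] // := @perm_component_monomial_mx k n 1%g (fun i => A i i).
by rewrite -det_monomial_mx.
Qed.

Lemma mul_monomial_mx (k : closedFieldType) (n : nat) (s t : 'S_n)
    (f g : 'I_n -> k) :
  monomial_mx s f *m monomial_mx t g =
  monomial_mx (s * t)%g (fun i => f i * g (s i)).
Proof.
apply/matrixP => i j; rewrite !mxE (bigD1 (s i)) //= big1 ?addr0 => [|l ls].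
  by rewrite !mxE eqxx permM mulr1n mulrnAr.
by rewrite mxE (negbTE ls) mul0r.
Qed.

Lemma perm_componentM (k : closedFieldType) (n : nat) (s t : 'S_n)
    (A B : 'M[k]_n) :
  perm_component k n s A -> perm_component k n t B ->
  perm_component k n (s * t)%g (A *m B).
Proof.
move=> [A1 As] [B1 Bt]; split; first by rewrite /SL /= det_mulmx A1 B1 mulr1.
rewrite (monomialE As) (monomialE Bt) mul_monomial_mx; apply: monomial_mxP => i.
by rewrite mulf_neq0 ?As ?Bt.
Qed.

(** Row [i] of a power collects the coefficients met along the trajectory of [i] under [s]. Both the
    orders over full cycles and the elements of infinite order are read off from this product. *)
Lemma monomial_mxX (k : closedFieldType) (n : nat) (s : 'S_n)
    (f : 'I_n -> k) (m : nat) :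
  monomial_mx s f ^+ m =
  monomial_mx (s ^+ m)%g (fun i => \prod_(l < m) f (iter l s i)).
Proof.
elim: m => [|m IHm].
  apply/matrixP => i j; rewrite !mxE expg0 perm1 big_ord0 eq_sym.
  by case: eqP.
rewrite exprS IHm expgS -mulmxE mul_monomial_mx; congr monomial_mx.
apply/funext => i; rewrite big_ord_recl /=; congr (_ * _).
by apply: eq_bigr => l _; rewrite -iterSr.
Qed.

Lemma perm_component_inv (k : closedFieldType) (n : nat) (s : 'S_n)
    (A : 'M[k]_n) :
  perm_component k n s A -> perm_component k n s^-1%g (invmx A).
Proof.
move=> As; have [A1 sA] := As.
have Au : A \in unitmx by rewrite unitmxE A1 unitr1.
pose B := monomial_mx s^-1%g (fun j => (A (s^-1%g j) j)^-1).
suff BA : B *m A = 1%:M.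
  have -> : invmx A = B by rewrite -[B]mulmx1 -(mulmxV Au) mulmxA BA mul1mx.
  split; first by have := congr1 determinant BA; rewrite det_mulmx A1 det1 mulr1.
  by apply: monomial_mxP => j; rewrite invr_eq0 sA permKV.
rewrite (monomialE sA) mul_monomial_mx mulVg; apply/matrixP => i j.
by rewrite !mxE perm1 permKV mulVf ?sA ?permKV ?eqxx // eq_sym; case: eqP.
Qed.

(** The torus is the set over the identity permutation, and conjugation sends it to the set over
    [s * 1 * s^-1 = 1]. Conjugating by the inverse as well turns the inclusion into an equality. *)
Lemma perm_component_sub_normalizer (k : closedFieldType) (n : nat) (s : 'S_n) :
  perm_component k n s `<=` normalizer_SL (torus k n).
Proof.
move=> g gs; have [g1 _] := gs; split => //.
have gu : g \in unitmx by rewrite unitmxE g1 unitr1.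
have gV := perm_component_inv gs.
have conjT (t : 'S_n) (h h' u : 'M[k]_n) : perm_component k n t h ->
    perm_component k n t^-1%g h' -> torus k n u -> torus k n (h *m u *m h').
  move=> ht ht'; rewrite -!perm_component1 => u1.
  have := perm_componentM (perm_componentM ht u1) ht'.
  by rewrite mulg1 mulgV.
apply/seteqP; split => [_ [t Tt <-]|t Tt]; first exact: conjT gs gV Tt.
exists (invmx g *m t *m g).
  by apply: conjT gV _ Tt; rewrite invgK.
by rewrite !mulmxA mulmxV // mul1mx -mulmxA mulmxV // mulmx1.
Qed.

(** * The normalizer of the torus is monomial *)

(** The entries are 1, ..., n, distinct and nonzero in characteristic zero, rescaled by an n-th root
    of [1 / n!] to make the determinant 1. *)
Lemma regular_torus_element (k : closedFieldType) (n : nat) :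
  [pchar k] =i pred0 -> (0 < n)%N ->
  exists d : 'rV[k]_n, torus k n (diag_mx d) /\ injective (d ord0).
Proof.
move=> /pcharf0P char0 n0.
have nat0 m : (m.+1%:R : k) != 0 by rewrite char0.
pose a : k := (\prod_(i < n) i.+1%:R)^-1.
have a0 : a != 0 by rewrite invr_eq0; apply/prodf_neq0.
have /closed_rootP[c] : size ('X^n - a%:P) != 1.
  by rewrite size_XnsubC // eqSS -lt0n.
rewrite /root !hornerE subr_eq0 => /eqP cn.
have c0 : c != 0.
  by apply: contra_neq a0 => c0; rewrite -cn c0 expr0n eqn0Ngt n0.
exists (\row_i (c * i.+1%:R)); split => [|i j]; last first.
  rewrite !mxE => /(mulfI c0) /eqP; wlog ij : i j / (i <= j)%N => [W|].
    by case/orP: (leq_total i j) => /W // => + e =>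
      /(_ _)/esym; apply; rewrite eq_sym.
  rewrite -subr_eq0 -opprB oppr_eq0 -natrB // char0 subSS subn_eq0 => ji.
  by apply/val_inj/anti_leq; rewrite ij ji.
split; last exact: diag_mx_is_diag.
rewrite /SL /= det_diag.
under eq_bigr do rewrite mxE.
by rewrite big_split /= prodr_const card_ord cn mulVf // -invr_eq0.
Qed.

(** For a regular [d] in the torus, [A *m diag_mx d = B *m A] with [B] diagonal, so a nonzero entry
    [A i j] forces [d_j = B_ii]. As [d] has distinct entries, each row has at most one nonzero
    entry. *)
Lemma normalizer_torusE (k : closedFieldType) (n : nat) (A : 'M[k]_n) :
  [pchar k] =i pred0 -> (0 < n)%N ->
  normalizer_SL (torus k n) A <-> exists s, perm_component k n s A.
Proof.
move=> char0 n0; split => [[A1 normA]|[s]]; last exact: perm_component_sub_normalizer.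
have Au : A \in unitmx by rewrite unitmxE A1 unitr1.
have [d [Td d_inj]] := regular_torus_element char0 n0.
have [_ /is_diag_mxP dB] : torus k n (A *m diag_mx d *m invmx A).
  by rewrite -normA; exists (diag_mx d).
set B := A *m _ *m _ in dB.
have AE i j : A i j != 0 -> d ord0 j = B i i.
  move=> Aij; apply: (mulfI Aij).
  have /matrixP/(_ i j) : A *m diag_mx d = B *m A.
    by rewrite -mulmxA mulVmx // mulmx1.
  rewrite mul_mx_diag mxE => ->; rewrite mxE (bigD1 i) //= big1 ?addr0 1?mulrC //.
  by move=> l li; rewrite dB ?mul0r // eq_sym.
have A_neq0 j : exists i, A i j != 0.
  apply/existsP; apply: contraT => /existsPn Aj0.
  suff: \det A = 0 by rewrite A1 => /eqP; rewrite oner_eq0.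
  rewrite (expand_det_col _ j) big1 // => i _.
  by have /negPn/eqP-> := Aj0 i; rewrite mul0r.
have [f fA] := choice A_neq0.
have f_inj : injective f.
  by move=> i j fij; apply: d_inj; rewrite (AE _ _ (fA i)) (AE _ _ (fA j)) fij.
(* [f] sends a column to a row, whereas [monomial_of_perm] sends rows to columns, hence the
   inverse. *)
pose s := (perm f_inj)^-1%g.
have sA i : A i (s i) != 0 by rewrite -{1}[i](permKV (perm f_inj)) permE.
exists s; split => // i j; apply/idP/eqP => [Aij|->//].
by apply: d_inj; rewrite (AE _ _ Aij) (AE _ _ (sA i)).
Qed.

(** * Connectedness by rational curves *)

(** These are the elements of the localization of [k[x]] at [q], seen as functions whose values at
    the roots of [q] are arbitrary. The free exponent [N] gives closure under sums and products. *)
Definition regular_away (k : closedFieldType) (q : {poly k}) (f : k -> k) :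
    Prop :=
  exists P N, forall x, q.[x] != 0 -> f x = P.[x] / q.[x] ^+ N.

Lemma regular_away_horner (k : closedFieldType) (q P : {poly k}) :
  regular_away q (horner P).
Proof. by exists P, 0%N => x _; rewrite expr0 divr1. Qed.

Lemma regular_away_cst (k : closedFieldType) (q : {poly k}) c :
  regular_away q (fun=> c).
Proof. by exists c%:P, 0%N => x _; rewrite hornerC expr0 divr1. Qed.

Lemma regular_awayD (k : closedFieldType) (q : {poly k}) f g :
  regular_away q f -> regular_away q g -> regular_away q (fun x => f x + g x).
Proof.
move=> [P [N fP]] [P' [N' gP]]; exists (P * q ^+ N' + P' * q ^+ N), (N + N')%N.
move=> x qx; rewrite fP // gP // !hornerE addf_div ?expf_neq0 //.
by rewrite exprD.
Qed.

Lemma regular_awayM (k : closedFieldType) (q : {poly k}) f g :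
  regular_away q f -> regular_away q g -> regular_away q (fun x => f x * g x).
Proof.
move=> [P [N fP]] [P' [N' gP]]; exists (P * P'), (N + N')%N.
by move=> x qx; rewrite fP // gP // hornerM mulf_div exprD.
Qed.

Lemma regular_away_sum (k : closedFieldType) (q : {poly k}) (I : Type)
    (r : seq I) (f : I -> k -> k) :
  (forall i, regular_away q (f i)) ->
  regular_away q (fun x => \sum_(i <- r) f i x).
Proof.
move=> freg; elim: r => [|i r IHr].
  by under eq_fun do rewrite big_nil; exact: regular_away_cst.
by under eq_fun do rewrite big_cons; exact: regular_awayD.
Qed.

Lemma regular_away_prod (k : closedFieldType) (q : {poly k}) (I : Type)
    (r : seq I) (f : I -> k -> k) :
  (forall i, regular_away q (f i)) ->
  regular_away q (fun x => \prod_(i <- r) f i x).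
Proof.
move=> freg; elim: r => [|i r IHr].
  by under eq_fun do rewrite big_nil; exact: regular_away_cst.
by under eq_fun do rewrite big_cons; exact: regular_awayM.
Qed.

Lemma regular_awayX (k : closedFieldType) (q : {poly k}) f m :
  regular_away q f -> regular_away q (fun x => f x ^+ m).
Proof.
move=> freg; elim: m => [|m IHm]; first exact: regular_away_cst.
by under eq_fun do rewrite exprS; exact: regular_awayM.
Qed.

Lemma regular_away_mx_eval (k : closedFieldType) (n : nat) (q : {poly k})
    (p : {mpoly k[n * n]}) (M : k -> 'M[k]_n) :
  (forall i j, regular_away q (fun x => M x i j)) ->
  regular_away q (fun x => mx_eval p (M x)).
Proof.
move=> Mreg; rewrite /mx_eval; under eq_fun do rewrite mevalE.
apply: regular_away_sum => m; apply: regular_awayM.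
  exact: regular_away_cst.
apply: regular_away_prod => i; apply: regular_awayX.
by case/mxvec_indexP: i => i j; under eq_fun do rewrite mxvecE.
Qed.

(** Suppose a relatively clopen part contained [A] but not [D]. Along a curve from [A] to [D], the
    part and its complement would pull back to nonempty open subsets of the line. These meet,
    because a nonzero polynomial over an infinite field has a nonroot. *)
Lemma connected_rational_curves (k : closedFieldType) (n : nat)
    (C : set 'M[k]_n) :
  (forall A B, C A -> C B -> exists (q : {poly k}) (M : k -> 'M[k]_n),
    [/\ q.[0] != 0 /\ q.[1] != 0, M 0 = A, M 1 = B,
      forall x, q.[x] != 0 -> C (M x)
    & forall i j, regular_away q (fun x => M x i j)]) ->
  connected (C : set (zariski_mx k n)).
Proof.
move=> curve E [A EA] [U [S ->] EU] [F cF EF].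
have [S' FE] : zariski_open (~` F) := closed_openC cF.
have {FE}FE : F = zero_locus S' by rewrite -[LHS]setCK FE setCK.
have [CA UA] : (C `&` ~` zero_locus S) A by rewrite -EU.
apply/seteqP; split => [D|D CD]; first by rewrite EU => -[].
rewrite EF; split => //; rewrite FE => p' Sp'.
apply: contrapT => /eqP p'D.
have [p [Sp /eqP pA]] : exists p, S p /\ ~ mx_eval p A = 0.
  by move: UA => /existsNP[p /not_implyP]; exists p.
have [q [M [[q0 q1] M0 M1 CM Mreg]]] := curve A D CA CD.
have [P [N MP]] := regular_away_mx_eval p Mreg.
have [P' [N' MP']] := regular_away_mx_eval p' Mreg.
have P0 : P != 0.
  apply: contra_neq pA => P0; rewrite -M0 MP // P0 horner0 mul0r //.
have P'0 : P' != 0.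
  apply: contra_neq p'D => P'0; rewrite -M1 MP' // P'0 horner0 mul0r //.
have qn0 : q != 0 by apply: contra_neq q0 => ->; rewrite horner0.
(* At a nonroot x of q P P', the point M x of the curve contradicts E being
   both C minus zero_locus S and C cut by zero_locus S'. *)
have /closed_nonrootP[x] : q * (P * P') != 0 by rewrite !mulf_neq0.
rewrite !rootM !negb_or /root => /and3P[qx Px P'x].
have : E (M x).
  rewrite EU; split; first exact: CM.
  move=> /(_ p Sp); rewrite MP // => /eqP.
  by rewrite mulf_eq0 (negbTE Px) invr_eq0 expf_eq0 (negbTE qx) andbF.
rewrite EF => -[_]; rewrite FE => /(_ p' Sp'); rewrite MP' // => /eqP.
by rewrite mulf_eq0 (negbTE P'x) invr_eq0 expf_eq0 (negbTE qx) andbF.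
Qed.

Lemma perm_component_connected (k : closedFieldType) (n : nat) (s : 'S_n) :
  connected (perm_component k n s : set (zariski_mx k n)).
Proof.
case: n s => [|n] s.
  (* For [n = 0] there is only one matrix. *)
  move=> E [A EA] _ [F _ EF]; apply/seteqP; split => B; first by rewrite EF => -[].
  move=> _.
  suff -> : B = A by [].
  by apply/matrixP => -[].
apply: connected_rational_curves => A B As Bs.
pose a i := A i (s i); pose b i := B i (s i).
pose h i : {poly k} := (a i)%:P + (b i - a i) *: 'X.
pose q := \prod_(i | i != ord0) h i.
have h0 i : (h i).[0] = a i by rewrite !hornerE.
have h1 i : (h i).[1] = b i by rewrite hornerD hornerC hornerZ hornerX mulr1 addrC subrK.
(* Linear interpolation of the nonzero entries, the one in row 0 being
   determined by the determinant. *)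
pose g x i := if i == ord0 then (-1) ^+ s / q.[x] else (h i).[x].
have last (C : 'M[k]_n.+1) : perm_component k n.+1 s C ->
    C ord0 (s ord0) = (-1) ^+ s / \prod_(i | i != ord0) C i (s i).
  move=> Cs; rewrite -(prod_perm_component Cs) (bigD1 ord0) //= mulfK //.
  by apply/prodf_neq0 => i _; case: Cs => _ /monomial_neq0.
have prod_neq0 (C : 'M[k]_n.+1) : perm_component k n.+1 s C ->
    \prod_(i | i != ord0) C i (s i) != 0.
  by move=> [_ Cs]; apply/prodf_neq0 => i _; exact: monomial_neq0.
have gE x (C : 'M[k]_n.+1) : perm_component k n.+1 s C ->
    (forall i, (h i).[x] = C i (s i)) -> monomial_mx s (g x) = C.
  move=> Cs hC; rewrite (monomialE Cs.2); congr monomial_mx; apply/funext => i.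
  rewrite /g; case: eqP => [->|_]; last exact: hC.
  by rewrite (last _ Cs) horner_prod; under eq_bigr do rewrite hC.
exists q, (fun x => monomial_mx s (g x)); split.
- rewrite !horner_prod; split.
    by under eq_bigr do rewrite h0; exact: prod_neq0.
  by under eq_bigr do rewrite h1; exact: prod_neq0.
- exact: gE.
- exact: gE.
- move=> x qx; apply: perm_component_monomial_mx.
  rewrite (bigD1 ord0) //= {1}/g eqxx.
  under eq_bigr => i /negbTE i0 do rewrite /g i0.
  by rewrite -horner_prod divfK // -signr_addb addbb.
- move=> i j; under eq_fun do rewrite mxE.
  case: (j == s i) => /=; last exact: regular_away_cst.
  rewrite /g; case: eqP => _; last exact: regular_away_horner.
  exists ((-1) ^+ s)%:P, 1%N => x _; by rewrite hornerC expr1.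
Qed.

(** * The connected components of the normalizer *)

Lemma closed_zero_locus (k : closedFieldType) (n : nat)
    (S : set {mpoly k[n * n]}) : closed (zero_locus S : set (zariski_mx k n)).
Proof. by rewrite -[zero_locus S]setCK; apply: open_closedC; exists S. Qed.

(** The set over [s] is connected, hence inside the component [K] of [A]. Conversely it cuts out a
    nonempty clopen part of the connected set [K], hence all of it. *)
Lemma connected_component_normalizer (k : closedFieldType) (n : nat) (s : 'S_n)
    (A : 'M[k]_n) : [pchar k] =i pred0 -> (0 < n)%N -> perm_component k n s A ->
  connected_component
    (normalizer_SL (torus k n) : set (zariski_mx k n)) A = perm_component k n s.
Proof.
move=> char0 n0 As; set N := normalizer_SL _.
have NA : N A by exact: perm_component_sub_normalizer As.
set K := connected_component _ _.
have Ksub : K `<=` N := @connected_component_sub _ _ _.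
pose x i j : {mpoly k[n * n]} := 'X_(mxvec_index i j).
have xE i j (B : 'M[k]_n) : mx_eval (x i j) B = B i j.
  by rewrite /mx_eval mevalXU mxvecE.
apply/seteqP; split; last first.
  apply: connected_component_max => //; last exact: perm_component_connected.
  exact: perm_component_sub_normalizer.
suff <- : K `&` perm_component k n s = K by move=> B [].
apply: component_connected.
- by exists A; split => //; exact: connected_component_refl.
(* Open condition: among monomial matrices, those over [s] are the ones where all entries at
   [(i, s i)] are nonzero. *)
- exists (~` zero_locus [set \prod_i x i (s i)]); first by eexists.
  apply/seteqP; split => B [KB].
    move=> [_ Bs]; split=> // /(_ _ erefl) /eqP.
    rewrite /mx_eval rmorph_prod /= prodf_seq_eq0 => /hasP[i _] /=.
    by rewrite -/(mx_eval _ _) xE; apply/negP; exact: monomial_neq0.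
  move=> nB; split=> //; have [t Bt] := (normalizer_torusE B char0 n0).1 (Ksub _ KB).
  suff -> : s = t by [].
  apply/permP => i; apply/eqP; rewrite -Bt.2.
  apply: contra_notN nB => /eqP Bi _ ->.
  by rewrite /mx_eval rmorph_prod /= (bigD1 i) //= -/(mx_eval _ _) xE Bi mul0r.
(* Closed condition: the same matrices are those where all entries off the positions [(i, s i)]
   vanish. *)
- exists (zero_locus [set p | exists i j, j != s i /\ p = x i j]).
    exact: closed_zero_locus.
  apply/seteqP; split => B [KB].
    move=> [_ Bs]; split=> // _ [i [j [ij ->]]]; rewrite xE.
    by apply/eqP; rewrite -[_ == _]negbK Bs.
  move=> B0; split=> //; have [t Bt] := (normalizer_torusE B char0 n0).1 (Ksub _ KB).
  suff -> : s = t by [].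
  apply/permP => i; apply/esym/eqP.
  apply: contraTT (monomial_neq0 i Bt.2) => ti; rewrite negbK -xE.
  by apply/eqP/B0; exists i, (t i).
Qed.

Lemma is_component_normalizer (k : closedFieldType) (n : nat) :
  [pchar k] =i pred0 -> (0 < n)%N ->
  [set C | is_component (normalizer_SL (torus k n)) C] =
  range (perm_component k n).
Proof.
move=> char0 n0; apply/seteqP; split => [_ [A NA ->]|_ [s _ <-]].
  have [s As] := (normalizer_torusE A char0 n0).1 NA.
  by exists s => //; rewrite (connected_component_normalizer char0 n0 As).
have [A As] := perm_component_neq0 k s n0.
exists A; first exact: perm_component_sub_normalizer As.
by rewrite (connected_component_normalizer char0 n0 As).
Qed.

Lemma perm_component_inj (k : closedFieldType) (n : nat) :
  (0 < n)%N -> injective (perm_component k n).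
Proof.
move=> n0 s t st; have [A As] := perm_component_neq0 k s n0.
have At : perm_component k n t A by rewrite -st.
exact: monomial_perm_inj As.2 At.2.
Qed.

(** * Cycles of full length *)

(** A duplicate-free list of [n] points exhausts ['I_n], so an n-cycle is a transitive permutation.
    Transitivity is the form used below. *)
Lemma cycle_of_full_length (n : nat) (s : 'S_n) :
  (0 < n)%N -> is_cycle_of_length n s <-> forall i j, fconnect s i j.
Proof.
case: n s => // n s _; split=> [[c [cn cU cs _]] i j|s_full].
  have cT l : l \in c.
    have : c =i predT; last by move->.
    apply/subset_cardP; last exact/subset_predT.
    by rewrite (card_uniqP cU) cn card_ord.
  by rewrite (fconnect_cycle cs).
exists (fingraph.orbit s ord0); split.
- rewrite size_orbit -[RHS]card_ord; apply: eq_card => i.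
  by rewrite !inE; exact: s_full.
- exact: orbit_uniq.
- exact/cycle_orbit/perm_inj.
- by move=> i; rewrite -fconnect_orbit s_full.
Qed.

Lemma order_full (n : nat) (s : 'S_n) i :
  (forall i j, fconnect s i j) -> fingraph.order s i = n.
Proof.
move=> s_full; rewrite -[RHS]card_ord; apply: eq_card => j.
by rewrite !inE; exact: s_full.
Qed.

Lemma iter_full_cycle (n : nat) (s : 'S_n) i :
  (forall i j, fconnect s i j) -> iter n s i = i.
Proof.
by move=> /order_full o; have := iter_order (@perm_inj _ s) i; rewrite o.
Qed.

Lemma odd_full_cycle (n : nat) (s : 'S_n) :
  (0 < n)%N -> (forall i j, fconnect s i j) -> odd_perm s = ~~ odd n.
Proof.
case: n s => // n s _ s_full.
suff sT : porbits s = [set [set: 'I_n.+1]%SET]%SET.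
  (* The parity of a permutation is that of the number of points plus the number of orbits, here
     one. *)
  by rewrite /odd_perm sT cards1 card_ord addbT.
have orbT i : porbit s i = [set: 'I_n.+1]%SET.
  apply/setP => j; rewrite inE; apply/porbitP; exists (findex s i j).
  by rewrite permX iter_findex.
apply/setP => X; rewrite inE; apply/imsetP/eqP => [[i _ ->]|->]; first exact: orbT.
by exists (ord0 : 'I_n.+1); rewrite ?orbT.
Qed.

Lemma iter_full_cycle_eq (n : nat) (s : 'S_n) i m :
  (forall i j, fconnect s i j) -> iter m s i = i -> (n %| m)%N.
Proof.
move=> s_full.
have n0 : (0 < n)%N by apply: leq_ltn_trans (ltn_ord i).
rewrite /dvdn {1}(divn_eq m n) addnC iterD.
have -> : iter (m %/ n * n) s i = i.
  elim: (m %/ n)%N => // d IHd; rewrite mulSn iterD IHd.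
  exact: iter_full_cycle.
move=> /(congr1 (findex s i)); rewrite findex0 findex_iter => [->//|].
by rewrite order_full ?ltn_mod.
Qed.

(** * Orders of the elements over a permutation *)

Lemma full_cycleX (k : closedFieldType) (n : nat) (s : 'S_n) (A : 'M[k]_n) :
  (0 < n)%N -> (forall i j, fconnect s i j) -> perm_component k n s A ->
  A ^+ n = ((-1) ^+ (~~ odd n))%:M.
Proof.
move=> n0 s_full As; rewrite -(odd_full_cycle n0 s_full).
rewrite -(prod_perm_component As) {1}(monomialE As.2) monomial_mxX.
apply/matrixP => i j; rewrite !mxE.
have si : (s ^+ n)%g i = i by rewrite permX iter_full_cycle.
rewrite si eq_sym; congr (_ *+ _).
(* The first [n] iterates of [i] visit every row once, so the product along them is the product over
   all rows. *)
have h_inj : injective (fun l : 'I_n => iter l s i).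
  move=> a b /(congr1 (findex s i)); rewrite !findex_iter ?order_full //.
  exact: val_inj.
by rewrite [RHS](reindex_inj h_inj).
Qed.

Lemma has_order_dvd (k : closedFieldType) (n m : nat) (A : 'M[k]_n) :
  (0 < m)%N -> A ^+ m = 1 -> (forall j, A ^+ j = 1 -> (m %| j)%N) -> has_order A m.
Proof.
move=> m0 Am Adv; split=> // j /andP[j0 jm] /Adv /(dvdn_leq j0).
by rewrite leqNgt jm.
Qed.

Lemma has_order_full_cycle (k : closedFieldType) (n : nat) (s : 'S_n)
    (A : 'M[k]_n) :
  [pchar k] =i pred0 -> (0 < n)%N -> (forall i j, fconnect s i j) ->
  perm_component k n s A -> has_order A (if odd n then n else (2 * n)%N).
Proof.
move=> /pcharf0P char0 n0 s_full As.
pose i0 := Ordinal n0.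
have An := full_cycleX n0 s_full As.
(* Entry [(i0, s^j i0)] of [A ^+ j] is a product of nonzero entries. In the identity matrix it must
   lie on the diagonal, so [s^j] fixes [i0]. *)
have Adv j : A ^+ j = 1 -> (n %| j)%N.
  rewrite (monomialE As.2) monomial_mxX => Aj.
  apply: (iter_full_cycle_eq (i := i0) s_full).
  move/matrixP/(_ i0 (iter j s i0)): (Aj); rewrite !mxE permX eqxx mulr1n.
  case: eqP => // _ /eqP; rewrite prodf_seq_eq0 => /hasP[l _] /=.
  by rewrite (negbTE (monomial_neq0 _ As.2)).
apply: has_order_dvd.
- by case: odd; rewrite ?muln_gt0.
- case: ifP An => [_|_]; first by move->.
  by rewrite mulnC exprM => ->; rewrite expr1 expr2 -mulmxE -scalar_mxM mulrNN mulr1.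
move=> j Aj; have nj := Adv j Aj; case: ifP => // n_even.
(* For even [n], [A ^+ n] is -1, so [A ^+ j = 1] forces [j / n] to be even, since -1 differs from 1
   in characteristic zero. *)
move: Aj; rewrite -{1}(divnK nj) mulnC exprM An n_even /= expr1 => /matrixP/(_ i0 i0).
have scX (c : k) d : (c%:M : 'M[k]_n) ^+ d = (c ^+ d)%:M.
  by elim: d => // d IHd; rewrite !exprS IHd -mulmxE -scalar_mxM.
rewrite scX !mxE eqxx /= !mulr1n => /eqP.
rewrite -signr_odd; case: (boolP (odd (j %/ n))) => [_|jn _].
  by rewrite expr1 -subr_eq0 -opprD oppr_eq0 -[_ + _]/(2%:R) char0.
by rewrite -(divnK nj) dvdn_pmul2r // dvdn2.
Qed.

Lemma periodic_full_cycle (k : closedFieldType) (n : nat) (s : 'S_n) :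
  [pchar k] =i pred0 -> periodic (perm_component k n s) ->
  forall i j, fconnect s i j.
Proof.
move=> /pcharf0P char0 per x y; apply: contraT => xy.
have nxy : x != y by apply: contra xy => /eqP ->; exact: connect0.
pose f z : k := if z == x then 2 else if z == y then (-1) ^+ s / 2 else 1.
have [|m [m0 /matrixP/(_ x (iter m s x)) Am _]] := per (monomial_mx s f).
  apply: perm_component_monomial_mx.
  rewrite (bigD1 x) //= (bigD1 y) 1?eq_sym //= big1 => [|z /andP[zx zy]].
    rewrite /f eqxx eq_sym (negbTE nxy) eqxx mulr1 [2 * _]mulrC divfK ?char0 //.
    by rewrite -signr_addb addbb.
  by rewrite /f (negbTE zx) (negbTE zy).
(* The trajectory of [x] never meets [y], so the compensating coefficient at [y] does not occur. *)
have fpow l : f (iter l s x) = 2 ^+ (iter l s x == x).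
  rewrite /f; case: eqP => // _; case: eqP => // ly.
  by move: xy; rewrite -ly fconnect_iter.
move: Am; rewrite monomial_mxX !mxE permX eqxx mulr1n.
under eq_bigr do rewrite fpow.
rewrite -expr_sum; case: m m0 => // m _.
(* The term [l = 0] is a visit to [x], so the exponent of 2 is positive. Such a power is neither 0
   nor 1 in characteristic zero, the only entries of the identity matrix. *)
rewrite big_ord_recl /= eqxx add1n -natrX.
set c := (\sum_(i < m) _)%N.
case: eqP => _ /eqP; last by rewrite char0 expn_eq0.
rewrite -[X in _ == X]/(1%:R) -subr_eq0 -natrB ?expn_gt0 // char0.
by rewrite subn_eq0 leqNgt -{1}(expn0 2) ltn_exp2l.
Qed.

(** * Counting the full cycles *)

Lemma card_full_cycles (n : nat) :
  #|[set s : 'S_n.+1 | [forall i, forall j, fconnect s i j]]%SET| = n`!.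
Proof.
pose c := perm (@ordS_inj n.+1).
have iter_c l i : iter l c i = ((i + l) %% n.+1)%N :> nat.
  elim: l => [|l IHl]; first by rewrite addn0 modn_small.
  by rewrite iterS permE /= IHl -addn1 modnDml addn1 addnS.
have iter_c0 (i : 'I_n.+1) : iter i c ord0 = i.
  by apply/val_inj; rewrite /= iter_c add0n modn_small.
have iterJ p l i : iter l (c ^ p)%g (p i) = p (iter l c i).
  by elim: l => //= l ->; rewrite permJ.
pose P := [set p : 'S_n.+1 | perm_on ([set: 'I_n.+1] :\ ord0) p]%SET.
have P0 p : (p \in P) = (p ord0 == ord0).
  rewrite inE; apply/idP/eqP => [/out_perm-> //|p0].
    by rewrite !inE eqxx.
  rewrite /perm_on; apply/fintype.subsetP => i; rewrite !inE andbT.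
  by apply: contraNneq => ->; rewrite p0.
have -> : n`! = #|P|.
  rewrite cardsE card_perm; congr _`!.
  by have := cardsD1 ord0 [set: 'I_n.+1]%SET; rewrite inE cardsT card_ord => -[].
(* If [p] fixes 0, the conjugate determines it: [p i] is the i-th iterate of 0 under [c ^ p]. *)
have J_inj : {in P &, injective (fun p => c ^ p)%g}.
  move=> p q; rewrite !P0 => /eqP p0 /eqP q0 /= pq; apply/permP => i.
  by rewrite -[i]iter_c0 -!iterJ p0 q0 pq.
rewrite -(card_in_imset J_inj); apply: eq_card => s; rewrite inE.
apply/idP/imsetP => [/forallP s_full0|[p _ ->]]; last first.
  apply/forallP => i; apply/forallP => j.
  rewrite -[i](permKV p) -[j](permKV p).
  move: (p^-1 i)%g (p^-1 j)%g => {}i {}j.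
  (* Adding [n.+1] avoids truncated subtraction when [j < i]. *)
  have -> : j = iter (j + (n.+1 - i)) c i.
    apply/val_inj; rewrite /= iter_c addnCA subnKC 1?ltnW //.
    by rewrite modnDr modn_small.
  by rewrite -iterJ fconnect_iter.
have s_full i j : fconnect s i j by exact: (forallP (s_full0 i)).
(* The only possible conjugator fixing 0 sends [i] to the i-th iterate of 0 under [s]. *)
have f_inj : injective (fun i : 'I_n.+1 => iter i s ord0).
  move=> i j /(congr1 (findex s ord0)); rewrite !findex_iter ?order_full //.
  exact: val_inj.
exists (perm f_inj); first by rewrite P0 permE.
apply/permP => i; rewrite -[i](permKV (perm f_inj)) permJ.
move: ((perm f_inj)^-1 i)%g => {}i; rewrite !permE -iterS.
(* Wrap-around occurs only at [i = n], where [ordS i] is 0 and [s] has returned to 0 after [n.+1]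
   steps. *)
have -> : nat_of_ord (ordS i) = (i.+1 %% n.+1)%N by [].
have [in1|] := ltnP i.+1 n.+1; first by rewrite modn_small.
move=> ni; have -> : i.+1 = n.+1 by apply/anti_leq; rewrite ni ltn_ord.
by rewrite modnn iter_full_cycle.
Qed.

(** * From permutations to periodic components *)

Lemma card_eq_finset (T : finType) (Z : {set T}) : ([set` Z] #= `I_#|Z|)%card.
Proof.
have -> : [set` Z] = range (@enum_val T (mem Z)).
  apply/seteqP; split => [x xZ|_ [i _ <-]]; last exact: enum_valP.
  by exists (enum_rank_in xZ x) => //; rewrite enum_rankK_in.
apply: card_eq_trans (card_esym card_II).
by apply: inj_card_eq => i j _ _; exact: enum_val_inj.
Qed.

Theorem mainTheorem8 (k : closedFieldType) (n : nat)
    (char0 : [pchar k] =i pred0) (n_ge2 : (2 <= n)%N) :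
  let T := torus k n in
  let N := normalizer_SL T in
  (* the identification of the set of components with N(T)/T = S_n *)
  [/\ set_bij [set: 'S_n] [set C | is_component N C] (perm_component k n),
      perm_component k n 1%g = T
    & forall (s t : 'S_n) (A B : 'M[k]_n),
        perm_component k n s A -> perm_component k n t B ->
        perm_component k n (s * t)%g (A *m B)] /\
  [/\ forall s : 'S_n,
        periodic (perm_component k n s) <-> is_cycle_of_length n s,
      ([set C | is_component N C /\ periodic C] #= `I_(n.-1)`!)%card
    & forall C : set 'M[k]_n, is_component N C -> periodic C ->
        forall A, C A -> has_order A (if odd n then n else (2 * n)%N)].
Proof.
have n0 : (0 < n)%N by apply: leq_trans n_ge2.
move=> T N; have compE := is_component_normalizer char0 n0.
have comp_inj := @perm_component_inj k n n0.
have perE (s : 'S_n) : periodic (perm_component k n s) <->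
    forall i j, fconnect s i j.
  split; first exact: periodic_full_cycle.
  move=> s_full A As; eexists; exact: has_order_full_cycle As.
split; split.
- split=> [s _|s t _ _|C].
  + by rewrite compE; exists s.
  + exact: comp_inj.
  + by rewrite compE.
- exact: perm_component1.
- exact: perm_componentM.
- by move=> s; rewrite perE cycle_of_full_length.
(* The periodic components are the injective image of the set of full cycles, so the count carries
   over. *)
- pose Z := [set s : 'S_n | [forall i, forall j, fconnect s i j]]%SET.
  have ZP s : s \in Z <-> forall i j, fconnect s i j.
    rewrite inE; split=> [/forallP sZ i j|sZ]; first exact: (forallP (sZ i)).
    by apply/forallP => i; apply/forallP => j.
  have -> : [set C | is_component N C /\ periodic C] =
      perm_component k n @` [set` Z].
    apply/seteqP; split => [C [Ccomp Cper]|_ [s /ZP sZ <-]].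
      have [s _ sC] : range (perm_component k n) C by rewrite -compE.
      by exists s => //; apply/ZP/perE; rewrite sC.
    split; last exact/perE.
    by have : range (perm_component k n) (perm_component k n s); [exists s|rewrite -compE].
  apply: card_eq_trans (inj_card_eq _) _; first by move=> s t _ _; exact: comp_inj.
  have <- : #|Z| = n.-1`!.
    by rewrite -(card_full_cycles n.-1) /Z; case: (n) n0.
  exact: card_eq_finset.
- move=> C Ccomp Cper A CA.
  have [s _ sC] : range (perm_component k n) C by rewrite -compE.
  move: Cper CA; rewrite -sC => /perE s_full As.
  exact: has_order_full_cycle s_full As.
Qed.
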